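(* Let $c\in(1/2,2)$ and let $\psi$ be the analytic function on the unit disk $\mathbb{D}=\{z\in\mathbb{C}:|z|<1\}$ with $\psi(0)=1$ given by $$\psi(z)=\begin{cases}\dfrac{(c-1)z}{1-z}\cdot\dfrac{1}{1-(1-z)^{c-1}}, & c\neq 1,\\[2mm] \dfrac{-z}{(1-z)\log(1-z)}, & c=1.\end{cases}$$ Then $\psi$ is not convex in $\mathbb{D}$.
   Context: Powers and logarithms of $1-z$ are principal branches on $\mathbb{D}$; the singularity of $\psi$ at $z=0$ is removable, with value $1$. Equivalently, $\psi(z)=zf_c'(z)/f_c(z)$, where $f_c(z)=\frac{(1-z)^{1-c}-1}{c-1}$ for $c\neq1$ and $f_c(z)=-\log(1-z)$ for $c=1$. An analytic function $\psi$ on $\mathbb{D}$ is called convex if it is univalent and $\psi(\mathbb{D})$ is a convex set; equivalently (for $\psi'(0)\ne 0$), if $\operatorname{Re}\left(1+\frac{z\psi''(z)}{\psi'(z)}\right)>0$ for all $z\in\mathbb{D}$. *)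

(* Defs.v *)
From Stdlib Require Export Reals.
From Stdlib Require Import Lra.
From Coquelicot Require Export Coquelicot.
Open Scope R_scope.

Definition Cexp (z : C) : C := (exp (Re z) * cos (Im z), exp (Re z) * sin (Im z)).

(* Principal argument, in ]-PI, PI]; meaningless at 0. *)
Definition Carg (w : C) : R :=
  if Rle_dec 0 (Im w) then acos (Re w / Cmod w) else - acos (Re w / Cmod w).

Definition Clog (w : C) : C := (ln (Cmod w), Carg w).

Definition Cpower (w : C) (a : R) : C := Cexp (RtoC a * Clog w)%C.

Lemma Cmod2 (w : C) : Cmod w * Cmod w = Re w * Re w + Im w * Im w.
Proof.
unfold Cmod, Re, Im. rewrite sqrt_sqrt; [ring | nra].
Qed.

Lemma Re_div_Cmod_bound (w : C) : w <> 0%C -> -1 <= Re w / Cmod w <= 1.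
Proof.
intros Hw. pose proof (proj1 (Cmod_gt_0 w) Hw) as H. pose proof (Cmod2 w) as H2.
split.
- apply Rmult_le_reg_r with (Cmod w); [exact H|].
  unfold Rdiv. rewrite Rmult_assoc, Rinv_l by lra. nra.
- apply Rmult_le_reg_r with (Cmod w); [exact H|].
  unfold Rdiv. rewrite Rmult_assoc, Rinv_l by lra. nra.
Qed.

Lemma Carg_bound (w : C) : w <> 0%C -> - PI < Carg w <= PI.
Proof.
intros Hw. pose proof (proj1 (Cmod_gt_0 w) Hw) as H. pose proof (Cmod2 w) as H2.
pose proof (Re_div_Cmod_bound w Hw) as Hb. pose proof PI_RGT_0 as HPI.
pose proof (acos_bound (Re w / Cmod w)) as [Ha0 Ha1].
unfold Carg. destruct (Rle_dec 0 (Im w)) as [Hi | Hi]; [lra|].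
split; [|lra].
destruct (Req_dec (acos (Re w / Cmod w)) PI) as [Heq | Hne]; [exfalso | lra].
pose proof (cos_acos _ Hb) as Hc. rewrite Heq, cos_PI in Hc.
assert (Hr : Re w = - Cmod w) by (replace (Re w) with (Re w / Cmod w * Cmod w) by (field; lra); rewrite <- Hc; ring).
rewrite Hr in H2. nra.
Qed.

Lemma Cexp_Clog (w : C) : w <> 0%C -> Cexp (Clog w) = w.
Proof.
intros Hw. pose proof (proj1 (Cmod_gt_0 w) Hw) as H. pose proof (Cmod2 w) as H2.
pose proof (Re_div_Cmod_bound w Hw) as Hb.
assert (Hs : Cmod w * sin (acos (Re w / Cmod w)) = Rabs (Im w)).
{ rewrite sin_acos by exact Hb. rewrite <- sqrt_Rsqr_abs.
  rewrite <- (sqrt_square (Cmod w)) at 1 by lra.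
  rewrite <- sqrt_mult_alt by nra. f_equal. unfold Rsqr.
  replace (Cmod w * Cmod w * (1 - Re w / Cmod w * (Re w / Cmod w)))
    with (Cmod w * Cmod w - Re w * Re w) by (field; lra).
  lra. }
unfold Cexp, Clog; simpl. rewrite exp_ln by exact H.
transitivity (Re w, Im w); [|destruct w; reflexivity].
unfold Carg. destruct (Rle_dec 0 (Im w)) as [Hi | Hi]; f_equal.
- rewrite cos_acos by exact Hb. field. lra.
- rewrite Hs. apply Rabs_pos_eq; exact Hi.
- rewrite cos_neg, cos_acos by exact Hb. field. lra.
- rewrite sin_neg. rewrite Rabs_left in Hs by lra. lra.
Qed.

Definition unit_disk (z : C) : Prop := Cmod z < 1.

(* At z = 0 the value is that of the removable singularity. *)
Definition psi (c : R) (z : C) : C :=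
  if Ceq_dec z 0 then 1%C
  else if Req_dec_T c 1 then (- z / ((1 - z) * Clog (1 - z)))%C
  else (RtoC (c - 1) * z / (1 - z) * (1 / (1 - Cpower (1 - z) (c - 1))))%C.

Definition convex_subset (S : C -> Prop) : Prop :=
  forall (p q : C) (t : R), S p -> S q -> 0 <= t <= 1 ->
    S (RtoC (1 - t) * p + RtoC t * q)%C.

Definition univalent_on (D : C -> Prop) (f : C -> C) : Prop :=
  forall z1 z2 : C, D z1 -> D z2 -> f z1 = f z2 -> z1 = z2.

Definition image_of (D : C -> Prop) (f : C -> C) (w : C) : Prop :=
  exists z : C, D z /\ f z = w.

(* The notion is meant for functions analytic on the disk. Analyticity is not
   a conjunct, so that the negation says more than a failure of analyticity. *)
Definition convex_in_unit_disk (f : C -> C) : Prop :=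
  univalent_on unit_disk f /\ convex_subset (image_of unit_disk f).

(* Main.v *)
Require Import Defs.
From Stdlib Require Import Reals Lra Psatz.
From Coquelicot Require Import Coquelicot.
Open Scope R_scope.

(** The image of the disk fails to be convex near infinity, at the boundary
    point [z = 1].

    Put [s = 1 / (1 - z)], which maps the disk onto the half-plane
    [Re s > 1 / 2], and [a = c - 1], so that [-1 / 2 < a < 1] and
    [psi = a (s - 1) / (1 - s ^ (- a))]. As [s] tends to infinity, the
    expansion of [psi] begins with [a s + a s ^ (1 - a)] if [a > 0], with
    [b s ^ (1 - b) + b s ^ (1 - 2 b)] if [a = - b < 0], and for [a = 0] one has
    [psi = (s - 1) / log s]. The leading term maps the right half-plane onto a
    half-plane or onto a sector of opening less than [PI], and the upper
    imaginary axis onto its upper edge. The next term, or for [a = 0] the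
    argument of [log s], pushes the boundary of the image inwards, away from
    this edge, by a distance that tends to infinity but is negligible compared
    with the distance to the origin. A boundary curve like that of
    the region [x > |y| ^ beta] with [0 < beta < 1] results, and such a region is not
    convex.

    To make this precise, let [tilt phi p] be the real part of
    [exp (i phi) * p], with [phi] chosen so that the edge becomes vertical:
    [phi = 0] for [a >= 0], and [phi = b PI / 2] for [a = - b < 0]. Two facts
    are needed. First, [tilt phi psi] tends to infinity as [s] does, uniformly in
    the half-plane ([tilt_grows_pos], [tilt_grows_zero], [tilt_grows_neg]);
    since [psi] is bounded for bounded [s] ([quotient_bounded]), the part of the
    image in any half-plane [tilt phi <= M] is bounded ([psi_half_plane_bounded]).
    Second, along [Re s = 1] the modulus of [psi] tends to infinity while
    [tilt phi psi / |psi|] becomes arbitrarily small ([escapes_quotient]). If the image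
    were convex, segments from a fixed point to points of the second kind would
    give arbitrarily distant points of the image in a fixed half-plane
    [tilt phi <= M], against the first fact ([not_convex_of_flat_escape]). *)

(** * Elementary inequalities for exp, sin and cos *)

Lemma exp_le (x y : R) : x <= y -> exp x <= exp y.
Proof. intros [H | ->]; [left; apply exp_increasing; exact H | right; reflexivity]. Qed.

Lemma sin_ge_div3 (u : R) : 0 <= u <= 2 -> u / 3 <= sin u.
Proof.
intros Hu. pose proof (proj1 (pre_sin_bound u 0 ltac:(lra) ltac:(lra))) as H.
unfold sin_approx, sin_term in H; simpl in H. nra.
Qed.

Lemma sin_sq_le (u : R) : sin u * sin u <= u * u.
Proof.
assert (main : forall v, 0 <= v -> sin v * sin v <= v * v).
{ intros v Hv. pose proof (SIN_bound v). pose proof PI2_3_2.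
  destruct (Req_dec v 0) as [-> | Hn]; [rewrite sin_0; lra|].
  pose proof (sin_lt_x v ltac:(lra)).
  destruct (Rle_dec v 1) as [h | h]; [|nra].
  assert (0 <= sin v) by (apply sin_ge_0; lra). nra. }
destruct (Rle_dec 0 u) as [H | H]; [apply main; exact H|].
pose proof (main (- u) ltac:(lra)) as Hm. rewrite sin_neg in Hm. lra.
Qed.

Lemma sin_ge_on_arch (u y : R) : 0 <= u -> u <= y <= PI - u -> sin u <= sin y.
Proof.
intros Hu Hy. destruct (Rle_dec y (PI / 2)) as [H | H].
- apply sin_incr_1; lra.
- rewrite <- (sin_PI_x u). apply sin_decr_1; lra.
Qed.

Lemma sin_sq_cos_sq (t : R) : sin t * sin t + cos t * cos t = 1.
Proof. pose proof (sin2_cos2 t) as H. unfold Rsqr in H. exact H. Qed.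

Lemma cos_ge_0_Rabs (t : R) : Rabs t <= PI / 2 -> 0 <= cos t.
Proof. intros H. apply Rabs_le_between in H. apply cos_ge_0; lra. Qed.

(** Below [PI / 2] the sine of [a t] is comparable to [a] times the sine of [t].
    With [cos t >= cos t ^ 2] this makes a combination of [cos t] and
    [sin t * sin (a t)] bounded below by a constant, uniformly in the direction
    [t]; that uniformity is what the growth estimate for [a > 0] rests on. *)
Lemma sin_mul_sin_ge (a t : R) :
  0 < a < 1 -> Rabs t <= PI / 2 -> a / 3 * (sin t * sin t) <= sin t * sin (a * t).
Proof.
intros Ha. pose proof PI_4 as HPI.
assert (main : forall u, 0 <= u <= PI / 2 ->
          a / 3 * (sin u * sin u) <= sin u * sin (a * u)).
{ intros u Hu.
  assert (H0 : 0 <= sin u) by (apply sin_ge_0; lra).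
  assert (H1 : sin u <= u).
  { destruct (Req_dec u 0) as [-> | Hn]; [rewrite sin_0; lra|].
    left; apply sin_lt_x; lra. }
  assert (H2 : a * u / 3 <= sin (a * u)) by (apply sin_ge_div3; nra).
  assert (H3 : a / 3 * sin u <= sin (a * u)) by nra.
  replace (a / 3 * (sin u * sin u)) with (sin u * (a / 3 * sin u)) by ring.
  apply Rmult_le_compat_l; lra. }
intros Ht. apply Rabs_le_between in Ht. destruct (Rle_dec 0 t) as [H | H].
- apply main; lra.
- pose proof (main (- t) ltac:(lra)) as Hm.
  replace (a * - t) with (- (a * t)) in Hm by ring.
  rewrite !sin_neg in Hm. lra.
Qed.

Lemma exp_sub1_ge_quadratic (x : R) : 0 <= x -> x + x * x / 4 <= exp x - 1.
Proof.
intros Hx. replace x with (x / 2 + x / 2) at 4 by field. rewrite exp_plus.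
pose proof (exp_ineq1_le (x / 2)). nra.
Qed.

Lemma exp_ge_cubic (x : R) : 0 <= x -> x * x * x / 27 + x <= exp x.
Proof.
intros Hx. replace x with (x / 3 + x / 3 + x / 3) at 5 by field.
rewrite !exp_plus. pose proof (exp_ineq1_le (x / 3)) as H.
set (e := exp (x / 3)) in *.
assert ((1 + x / 3) * (1 + x / 3) <= e * e) by nra.
assert ((1 + x / 3) * (1 + x / 3) * (1 + x/3) <= e * e * e) by (apply Rmult_le_compat; nra).
nra.
Qed.

Lemma exp_sub1_sq_ge (p P : R) :
  0 <= P -> - P <= p -> exp (- P) * exp (- P) * (p * p) <= (exp p - 1) * (exp p - 1).
Proof.
intros HP Hp. pose proof (exp_pos (- P)) as H0.
assert (H1 : exp (- P) <= 1) by (rewrite <- exp_0; apply exp_le; lra).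
destruct (Rle_dec 0 p) as [H | H].
- pose proof (exp_ineq1_le p) as H2.
  assert (exp (- P) * p <= exp p - 1) by nra.
  assert (0 <= exp (- P) * p) by nra. nra.
- assert (H2 : exp (- P) <= exp p) by (apply exp_le; lra).
  pose proof (exp_ineq1_le (- p)) as H3.
  assert (H4 : exp p * exp (- p) = 1) by (rewrite <- exp_plus, Rplus_opp_r; apply exp_0).
  assert (H5 : exp p * - p <= 1 - exp p) by (pose proof (exp_pos p); nra).
  assert (exp (- P) * - p <= 1 - exp p) by nra.
  assert (0 <= exp (- P) * - p) by nra. nra.
Qed.

Lemma one_minus_cos_ge (q : R) : Rabs q <= PI / 2 -> q * q / 18 <= 1 - cos q.
Proof.
intros Hq. apply Rabs_le_between in Hq. pose proof PI_4 as HPI.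
assert (main : forall u, 0 <= u <= PI / 2 -> u * u / 18 <= 1 - cos u).
{ intros u Hu. pose proof (sin_ge_div3 (u / 2) ltac:(lra)) as H.
  replace u with (2 * (u / 2)) at 3 by field. rewrite cos_2a_sin. nra. }
destruct (Rle_dec 0 q) as [H | H]; [apply main; lra|].
pose proof (main (- q) ltac:(lra)) as Hm. rewrite cos_neg in Hm. lra.
Qed.

(** * The function in logarithmic coordinates *)

(** With [L = - log (1 - z)] and [s = exp L = 1 / (1 - z)], the function
    [psi c] becomes [(s - 1) / ((1 - s ^ (- a)) / a)] where [a = c - 1]; the
    numerator is [numer L] and the denominator [denom a L], which for [a = 0]
    takes its limit value [log s = L]. The unit disk becomes the set of
    [L = x + i t] with [|t| < PI / 2] and [exp x * cos t > 1 / 2]. *)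
Definition numer (L : C) : C := (Cexp L - 1)%C.

Definition denom (a : R) (L : C) : C :=
  if Req_dec_T a 0 then L else ((1 - Cexp (RtoC (- a) * L)) / RtoC a)%C.

Lemma denom_0 (L : C) : denom 0 L = L.
Proof. unfold denom. destruct (Req_dec_T 0 0); [reflexivity | lra]. Qed.

Lemma denom_parts (a x t : R) : a <> 0 ->
  denom a (x, t) = ((1 - exp (- (a * x)) * cos (a * t)) / a,
                    exp (- (a * x)) * sin (a * t) / a).
Proof.
intros Ha. unfold denom. destruct (Req_dec_T a 0) as [H | _]; [contradiction|].
replace (RtoC (- a) * (x, t))%C with ((- (a * x), - (a * t)) : C)
  by (unfold Cmult, RtoC; simpl; f_equal; ring).
unfold Cexp. simpl. rewrite cos_neg, sin_neg.
unfold Cdiv, Cinv, Cmult, Cminus, Cplus, Copp, RtoC; simpl. f_equal; field; lra.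
Qed.

Lemma numer_parts (x t : R) : numer (x, t) = (exp x * cos t - 1, exp x * sin t).
Proof. unfold numer, Cexp, Cminus, Cplus, Copp, RtoC; simpl. f_equal; ring. Qed.

(** The right-hand side splits the squared modulus of [exp (p + i q) - 1] into
    a part that sees only [p] and a part that sees only [q], so two-sided
    bounds follow from one-variable estimates. *)
Lemma exp_polar_sq (p q : R) :
  (exp p * cos q - 1) * (exp p * cos q - 1) + exp p * sin q * (exp p * sin q)
  = (exp p - 1) * (exp p - 1) + 2 * exp p * (1 - cos q).
Proof. pose proof (sin_sq_cos_sq q). nra. Qed.

Lemma exp_polar_sq_ge (p q P : R) :
  0 <= P -> - P <= p -> Rabs q <= PI / 2 ->
  exp (- P) * exp (- P) / 9 * (p * p + q * q) <=
  (exp p - 1) * (exp p - 1) + 2 * exp p * (1 - cos q).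
Proof.
intros HP Hp Hq. pose proof (exp_sub1_sq_ge p P HP Hp) as H1.
pose proof (one_minus_cos_ge q Hq) as H2.
pose proof (exp_pos (- P)) as H0.
assert (H3 : exp (- P) <= 1) by (rewrite <- exp_0; apply exp_le; lra).
assert (H4 : exp (- P) <= exp p) by (apply exp_le; lra).
assert (H5 : exp (- P) * exp (- P) * (q * q / 9) <= exp p * (q * q / 9))
  by (apply Rmult_le_compat_r; nra).
assert (H6 : exp p * (q * q / 9) <= 2 * exp p * (1 - cos q)) by nra.
assert (0 <= exp (- P) * exp (- P) * (p * p)) by nra.
nra.
Qed.

Lemma exp_polar_sq_le (p q P : R) :
  0 <= P -> p <= P ->
  (exp p - 1) * (exp p - 1) + 2 * exp p * (1 - cos q)
  <= exp P * exp P * (p * p + q * q).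
Proof.
intros HP Hp. pose proof (exp_pos p) as H0.
assert (H1 : 1 <= exp P) by (rewrite <- exp_0; apply exp_le; lra).
assert (H2 : exp p <= exp P) by (apply exp_le; lra).
assert (H3 : 2 * (1 - cos q) <= q * q).
{ replace q with (2 * (q / 2)) at 1 by field. rewrite cos_2a_sin.
  pose proof (sin_sq_le (q / 2)). lra. }
assert (H4 : (exp p - 1) * (exp p - 1) <= exp P * exp P * (p * p)).
{ pose proof (exp_ineq1_le p) as h1. pose proof (exp_ineq1_le (- p)) as h2.
  assert (h3 : exp p * exp (- p) = 1) by (rewrite <- exp_plus, Rplus_opp_r; apply exp_0).
  assert (h4 : exp p - 1 <= exp p * p) by nra.
  destruct (Rle_dec 0 p) as [h | h].
  - assert (0 <= exp p - 1 <= exp P * p) by nra. nra.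
  - assert (0 <= 1 - exp p <= - p) by nra.
    assert ((exp p - 1) * (exp p - 1) <= p * p) by nra.
    assert (1 * (p * p) <= exp P * exp P * (p * p)) by (apply Rmult_le_compat_r; nra).
    lra. }
assert (H5 : exp p * (2 * (1 - cos q)) <= exp P * exp P * (q * q)).
{ pose proof (COS_bound q).
  assert (exp p * (2 * (1 - cos q)) <= exp P * (q * q)) by (apply Rmult_le_compat; lra).
  assert (1 * (exp P * (q * q)) <= exp P * (exp P * (q * q))) by (apply Rmult_le_compat_r; nra).
  lra. }
lra.
Qed.

Definition normsq (z : C) : R := Re z * Re z + Im z * Im z.

Lemma normsq_numer (x t : R) :
  normsq (numer (x, t)) = (exp x - 1) * (exp x - 1) + 2 * exp x * (1 - cos t).
Proof. rewrite numer_parts. unfold normsq; simpl. apply exp_polar_sq. Qed.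

Lemma normsq_denom (a x t : R) : a <> 0 ->
  a * a * normsq (denom a (x, t)) =
  (exp (- (a * x)) - 1) * (exp (- (a * x)) - 1) + 2 * exp (- (a * x)) * (1 - cos (a * t)).
Proof.
intros Ha. rewrite <- exp_polar_sq, denom_parts by exact Ha. unfold normsq; simpl. field. exact Ha.
Qed.

(** The denominator vanishes only to first order and only at [L = 0]: for
    [|a| < 1] the point [- a L] keeps its imaginary part within [PI / 2], away
    from the other zeros [2 k PI i] of [exp - 1]. *)
Lemma normsq_denom_ge (a x t X : R) :
  -1 < a < 1 -> 1 <= X -> -1 <= x <= X -> Rabs t <= PI / 2 ->
  exp (- X) * exp (- X) / 9 * (x * x + t * t) <= normsq (denom a (x, t)).
Proof.
intros Ha HX Hx Ht. pose proof (exp_pos (- X)) as H0.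
destruct (Req_dec a 0) as [-> | Hn].
- rewrite denom_0. unfold normsq; simpl.
  assert (exp (- X) <= 1) by (rewrite <- exp_0; apply exp_le; lra).
  assert (exp (- X) * exp (- X) / 9 <= 1) by nra.
  assert (exp (- X) * exp (- X) / 9 * (x * x + t * t) <= 1 * (x * x + t * t))
    by (apply Rmult_le_compat_r; nra). lra.
- assert (Hp : - X <= - (a * x)) by nra.
  assert (Hq : Rabs (a * t) <= PI / 2).
  { rewrite Rabs_mult. assert (Rabs a < 1) by (apply Rabs_def1; lra).
    pose proof (Rabs_pos a). pose proof (Rabs_pos t). nra. }
  pose proof (exp_polar_sq_ge (- (a * x)) (a * t) X ltac:(lra) Hp Hq) as H.
  rewrite <- (normsq_denom a x t Hn) in H.
  apply Rmult_le_reg_l with (a * a); [nra|].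
  eapply Rle_trans; [|exact H]. apply Req_le. field.
Qed.

Lemma denom_neq_0 (a x t : R) :
  -1 < a < 1 -> -1 <= x -> Rabs t <= PI / 2 -> (x, t) <> RtoC 0 -> denom a (x, t) <> 0%C.
Proof.
intros Ha Hx Ht HL Habs.
pose proof (normsq_denom_ge a x t (Rmax 1 x) Ha (Rmax_l _ _) (conj Hx (Rmax_r _ _)) Ht) as H.
rewrite Habs in H. unfold normsq in H; simpl in H.
pose proof (exp_pos (- Rmax 1 x)) as H0.
assert (H1 : 0 < exp (- Rmax 1 x) * exp (- Rmax 1 x) / 9) by nra.
assert (H2 : x * x + t * t <= 0) by nra.
apply HL. unfold RtoC. f_equal; apply Rsqr_0_uniq; unfold Rsqr; nra.
Qed.

Lemma normsq_Cmod (z : C) : normsq z = Cmod z * Cmod z.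
Proof. symmetry. apply Cmod2. Qed.

Lemma normsq_pos (z : C) : z <> 0%C -> 0 < normsq z.
Proof. intros Hz. rewrite normsq_Cmod. pose proof (proj1 (Cmod_gt_0 z) Hz). nra. Qed.

(** Numerator and denominator are both comparable to [|L|] when [x] is bounded,
    so the quotient stays bounded, even near its removable singularity. *)
Lemma quotient_bounded (a X : R) : -1 < a < 1 -> 1 <= X -> exists K : R,
  forall x t, -1 <= x <= X -> Rabs t <= PI / 2 -> (x, t) <> RtoC 0 ->
    Cmod (numer (x, t) / denom a (x, t)) <= K.
Proof.
intros Ha HX. pose proof (exp_pos X) as HE. pose proof (exp_pos (- X)) as HE'.
exists (exp X * 3 / exp (- X)). intros x t Hx Ht HL.
pose proof (denom_neq_0 a x t Ha (proj1 Hx) Ht HL) as Hd.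
rewrite Cmod_div by exact Hd.
pose proof (proj1 (Cmod_gt_0 _) Hd) as Hp.
apply Rmult_le_reg_r with (Cmod (denom a (x, t))); [exact Hp|].
unfold Rdiv at 1. rewrite Rmult_assoc, Rinv_l, Rmult_1_r by lra.
pose proof (normsq_denom_ge a x t X Ha HX Hx Ht) as H1. rewrite normsq_Cmod in H1.
pose proof (exp_polar_sq_le x t X ltac:(lra) (proj2 Hx)) as H2.
rewrite <- normsq_numer, normsq_Cmod in H2.
apply Rsqr_incr_0_var.
2:{ apply Rmult_le_pos; [|lra]. apply Rlt_le, Rdiv_lt_0_compat; lra. }
unfold Rsqr. eapply Rle_trans; [exact H2|].
replace (exp X * 3 / exp (- X) * Cmod (denom a (x, t)) * (exp X * 3 / exp (- X) * Cmod (denom a (x, t))))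
  with (exp X * exp X * (9 / (exp (- X) * exp (- X)) * (Cmod (denom a (x, t)) * Cmod (denom a (x, t)))))
  by (field; lra).
apply Rmult_le_compat_l; [nra|].
apply Rmult_le_reg_l with (exp (- X) * exp (- X) / 9); [nra|].
eapply Rle_trans; [exact H1|]. apply Req_le. field. lra.
Qed.

(** * Growth towards infinity in one direction *)

(** The real part of [exp (i phi) * p]. *)
Definition tilt (phi : R) (p : C) : R := cos phi * Re p - sin phi * Im p.

Lemma tilt_div (phi : R) (n d : C) : d <> 0%C ->
  tilt phi (n / d) = tilt phi (n * Cconj d) / normsq d.
Proof.
intros Hd. pose proof (normsq_pos d Hd) as H. destruct n as [n1 n2], d as [d1 d2].
unfold normsq in *; simpl in *.
unfold tilt, Cdiv, Cmult, Cconj, Cinv, Re, Im; simpl. field. nra.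
Qed.

(** The tilted real part of the quotient tends to infinity with [x],
    uniformly in [t]. It is stated without division, through
    [tilt (n / d) = tilt (n * conj d) / |d|^2]. *)
Definition tilt_grows (a phi : R) : Prop := forall M, 0 <= M -> exists X, forall x t,
  X <= x -> Rabs t <= PI / 2 ->
  M * normsq (denom a (x, t)) <= tilt phi (numer (x, t) * Cconj (denom a (x, t))).

(** Here the quotient is about [a s + a s ^ (1 - a)]. On the imaginary
    axis the first term contributes nothing to the real part, and the second
    contributes [a r ^ (1 - a) * sin (a PI / 2)], which is unbounded because
    [a < 1]. *)
Lemma tilt_grows_pos (a : R) : 0 < a < 1 -> tilt_grows a 0.
Proof.
intros Ha M HM.
(* Beyond the first summand [r ^ (- a) <= 1 / 2]; beyond the second the linear
   lower bound of [r ^ (1 - a)] outweighs [4 M / a + 2]. *)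
exists (/ a + (4 * M / a + 2) / (a / 3 * (1 - a))). intros x t Hx Ht.
assert (HQ : 0 <= (4 * M / a + 2) / (a / 3 * (1 - a))).
{ apply Rdiv_le_0_compat; [|nra].
  assert (0 <= M / a) by (apply Rdiv_le_0_compat; lra). unfold Rdiv in *; lra. }
assert (Hia : 0 < / a) by (apply Rinv_0_lt_compat; lra).
assert (H1 : (4 * M / a + 2) <= x * (a / 3 * (1 - a))).
{ apply Rle_div_l; [nra|]. lra. }
assert (H2 : 1 <= a * x).
{ replace 1 with (a * / a) by (field; lra). apply Rmult_le_compat_l; lra. }
rewrite numer_parts, denom_parts by lra.
unfold tilt, normsq, Cmult, Cconj; simpl. rewrite cos_0, sin_0.
set (e := exp (- (a * x))). set (r := exp x).
assert (He : 0 < e <= 1 / 2).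
{ split; [apply exp_pos|]. pose proof (exp_ineq1_le (a * x)).
  assert (e * exp (a * x) = 1) by (unfold e; rewrite <- exp_plus, Rplus_opp_l; apply exp_0).
  pose proof (exp_pos (- (a * x))). fold e in H3. nra. }
assert (Hre : 1 + (1 - a) * x <= r * e).
{ unfold r, e. rewrite <- exp_plus. eapply Rle_trans; [apply exp_ineq1_le|].
  apply Req_le; f_equal; ring. }
assert (Hr : 0 < r) by apply exp_pos.
pose proof (sin_mul_sin_ge a t Ha Ht) as Hs.
pose proof (cos_ge_0_Rabs t Ht) as Hc.
pose proof (COS_bound t) as Hct. pose proof (COS_bound (a * t)) as Hcat.
pose proof (sin_sq_cos_sq t) as Hsc.  pose proof (sin_sq_cos_sq (a * t)) as Hsca.
set (u := cos (a * t)) in *. set (v := sin (a * t)) in *.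
set (ct := cos t) in *. set (st := sin t) in *.
apply Rmult_le_reg_l with a; [lra|].
replace (a * (1 * ((r * ct - 1) * ((1 - e * u) / a) - r * st * - (e * v / a)) -
   0 * ((r * ct - 1) * - (e * v / a) + r * st * ((1 - e * u) / a))))
  with ((r * ct - 1) * (1 - e * u) + r * e * (st * v)) by (field; lra).
replace (a * (M * ((1 - e * u) / a * ((1 - e * u) / a) + e * v / a * (e * v / a))))
  with (M / a * (1 - 2 * e * u + e * e * (v * v + u * u))) by (field; lra).
rewrite Hsca.
assert (HMa : 0 <= M / a) by (apply Rdiv_le_0_compat; lra).
assert (B1 : M / a * (1 - 2 * e * u + e * e * 1) <= M / a * 4)
  by (apply Rmult_le_compat_l; nra).
assert (B2 : r * e * (a / 3 * (st * st)) <= r * e * (st * v))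
  by (apply Rmult_le_compat_l; nra).
assert (B3 : r * e * (a / 3 * (ct * ct)) <= r * ct * (1 - e * u)).
{ assert (1 / 2 <= 1 - e * u) by nra.
  assert (0 <= r * ct) by nra.
  assert (0 <= a / 3 * ct <= 1) by nra.
  assert (e * (a / 3 * ct) <= e * 1) by (apply Rmult_le_compat_l; lra).
  assert (e * (a / 3 * ct) <= 1 - e * u) by lra.
  replace (r * e * (a / 3 * (ct * ct))) with (r * ct * (e * (a / 3 * ct))) by ring.
  apply Rmult_le_compat_l; lra. }
assert (B4 : 1 - e * u <= 2) by nra.
assert (B5 : a / 3 * (1 + (1 - a) * x) <= r * e * (a / 3 * (st * st)) + r * e * (a / 3 * (ct * ct))).
{ replace (r * e * (a / 3 * (st * st)) + r * e * (a / 3 * (ct * ct)))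
    with (a / 3 * (r * e) * (st * st + ct * ct)) by ring.
  rewrite Hsc, Rmult_1_r. apply Rmult_le_compat_l; lra. }
unfold Rdiv in *. nra.
Qed.

(** The quotient is about [s / log s], whose real part near the imaginary axis
    is of order [r / (log r) ^ 2]: the argument of [log s] is small but not
    zero. *)
Lemma tilt_grows_zero : tilt_grows 0 0.
Proof.
intros M HM.
(* [135 = 5 * 27], where [|x + i t|^2 <= 5 x^2] and [exp x >= x^3 / 27]. *)
exists (2 + 135 * M). intros x t Hx Ht.
rewrite numer_parts, denom_0.
unfold tilt, normsq, Cmult, Cconj; simpl. rewrite cos_0, sin_0.
pose proof (exp_ge_cubic x ltac:(lra)) as He.
pose proof (cos_ge_0_Rabs t Ht) as Hc.
pose proof (COS_bound t) as Hct. pose proof (sin_sq_cos_sq t) as Hsc.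
assert (Hst : sin t * sin t <= t * sin t).
{ apply Rabs_le_between in Ht. pose proof PI2_3_2.
  destruct (Rtotal_order 0 t) as [H0 | [H0 | H0]].
  - pose proof (sin_lt_x t H0). assert (0 <= sin t) by (apply sin_ge_0; lra). nra.
  - rewrite <- H0, sin_0. lra.
  - pose proof (sin_lt_x (- t) ltac:(lra)) as h1.
    assert (h2 : 0 <= sin (- t)) by (apply sin_ge_0; lra). rewrite sin_neg in h1, h2. nra. }
assert (Ht2 : t * t <= 4).
{ apply Rabs_le_between in Ht. pose proof PI_4. nra. }
set (r := exp x) in *.
assert (Hr : 0 < r) by apply exp_pos.
assert (B1 : r * 1 <= r * (cos t * x + t * sin t)) by (apply Rmult_le_compat_l; nra).
assert (B2 : M * (x * x + t * t) <= M * (5 * (x * x))) by (apply Rmult_le_compat_l; nra).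
assert (B3 : M * 135 * (x * x) <= x * (x * x)) by (apply Rmult_le_compat_r; nra).
nra.
Qed.

(** Now the quotient is about [b s ^ (1 - b) + b s ^ (1 - 2 b)]. The first term
    fills a sector of half-angle [(1 - b) PI / 2], and [phi = b PI / 2] turns the
    upper edge of that sector onto the imaginary axis. There only the second
    term contributes to the tilted real part, and it is unbounded exactly because
    [b < 1 / 2]. *)
Lemma tilt_grows_neg (b : R) : 0 < b < 1 / 2 -> tilt_grows (- b) (b * PI / 2).
Proof.
intros Hb M HM. set (phi := b * PI / 2). pose proof PI_RGT_0 as HPI.
assert (Hphi : 0 < phi < PI / 4) by (unfold phi; nra).
(* [sg] bounds [sin (phi - eta)] below when [eta <= phi / 2], and [dl] bounds
   [sin ((1 - b) * eta)] below when [phi / 2 <= eta <= PI]. *)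
set (sg := sin (phi / 2)). set (dl := sin ((1 - b) * (phi / 2))).
assert (Hsg : 0 < sg) by (apply sin_gt_0; lra).
assert (Hdl : 0 < dl) by (apply sin_gt_0; nra).
(* Beyond the first summand [r ^ b * dl >= 2]; beyond the second
   [r ^ (1 - 2 b) * sg >= 4 M / b + 1]. *)
exists (2 / dl / b + (4 * M / b + 1) / ((1 - 2 * b) * sg)). intros x t Hx Ht.
assert (HMb : 0 <= M / b) by (apply Rdiv_le_0_compat; lra).
assert (HQ : 0 <= (4 * M / b + 1) / ((1 - 2 * b) * sg)).
{ apply Rdiv_le_0_compat; [unfold Rdiv in *; lra | nra]. }
assert (HQ2 : 0 < 2 / dl / b) by (repeat apply Rdiv_lt_0_compat; lra).
assert (H1 : 4 * M / b + 1 <= x * ((1 - 2 * b) * sg)) by (apply Rle_div_l; [nra | lra]).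
assert (H2 : 2 <= x * b * dl).
{ apply Rle_div_l; [lra|]. apply (Rle_div_l (2 / dl) x b); lra. }
rewrite numer_parts, denom_parts by lra.
unfold tilt, normsq, Cmult, Cconj; simpl.
replace (- (- b * x)) with (b * x) by ring.
replace (- b * t) with (- (b * t)) by ring. rewrite cos_neg, sin_neg.
set (k := exp (b * x)). set (r := exp x). set (m := exp ((1 - 2 * b) * x)).
assert (Hr : r = k * k * m) by (unfold r, k, m; rewrite <- !exp_plus; f_equal; ring).
assert (Hx0 : 0 < x) by lra.
assert (Hk : 1 + b * x <= k) by apply exp_ineq1_le.
assert (Hm : 1 + (1 - 2 * b) * x <= m) by apply exp_ineq1_le.
assert (Hbx : 0 < b * x) by nra. assert (Hbx' : 0 < (1 - 2 * b) * x) by nra.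
assert (Hkd : 2 <= k * dl).
{ assert (b * x * dl <= k * dl) by (apply Rmult_le_compat_r; lra). lra. }
assert (Hr0 : 0 < r) by apply exp_pos.
apply Rmult_le_reg_l with b; [lra|].
pose proof (sin_sq_cos_sq (b * t)) as Hsca.
set (u := cos (b * t)) in *. set (v := sin (b * t)) in *.
replace (b * (M * ((1 - k * u) / - b * ((1 - k * u) / - b) + k * - v / - b * (k * - v / - b))))
  with (M / b * (1 - 2 * k * u + k * k * (v * v + u * u))) by (field; lra).
rewrite Hsca.
assert (B1 : M / b * (1 - 2 * k * u + k * k * 1) <= M / b * (4 * (k * k))).
{ apply Rmult_le_compat_l; [lra|]. pose proof (COS_bound (b * t)). fold u in H. nra. }
set (eta := PI / 2 - t).
assert (Heta : 0 <= eta <= PI) by (apply Rabs_le_between in Ht; unfold eta; lra).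
assert (E1 : cos (t - b * t + phi) = sin ((1 - b) * eta)).
{ rewrite <- cos_shift. unfold eta, phi. f_equal. field. }
assert (E2 : cos (t + phi) = - sin (phi - eta)).
{ rewrite <- sin_neg, <- sin_shift. f_equal. unfold eta. ring. }

(* The real part of [exp (i phi) * (s - 1) * (conj (s ^ b) - 1)], expanded. *)
assert (E3 : b *
  (cos phi *
   ((r * cos t - 1) * ((1 - k * u) / - b) - r * sin t * - (k * - v / - b)) -
   sin phi *
   ((r * cos t - 1) * - (k * - v / - b) + r * sin t * ((1 - k * u) / - b)))
  = r * k * cos (t - b * t + phi) - r * cos (t + phi) - k * cos (b * t - phi) + cos phi).
{ rewrite !cos_plus, !sin_minus, !cos_minus. fold u v. field. lra. }
rewrite E3, E1, E2.
assert (S0 : 0 <= cos phi) by (apply cos_ge_0; lra).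
assert (S1 : 0 <= sin ((1 - b) * eta)) by (apply sin_ge_0; nra).
pose proof (COS_bound (b * t - phi)) as S3.
pose proof (SIN_bound (phi - eta)) as S4.
assert (Hmsg : 4 * M / b + 1 <= m * sg) by nra.
assert (Hsg1 : sg <= 1) by apply SIN_bound.
assert (Hk2 : 0 < k * k) by nra.
(* [eta] is the angle from [s] to the upper imaginary axis. Close to that axis
   [r * sin (phi - eta)] is positive of order [r]; away from it the larger
   term [r * k * sin ((1 - b) * eta)] absorbs everything else. *)
assert (Hmain : k * k * (m * sg) - k <=
  r * k * sin ((1 - b) * eta) + r * sin (phi - eta) - k * cos (b * t - phi)).
{ assert (k * cos (b * t - phi) <= k * 1) by (apply Rmult_le_compat_l; lra).
  destruct (Rle_dec eta (phi / 2)) as [He | He].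
  - assert (sg <= sin (phi - eta)) by (apply sin_ge_on_arch; lra).
    assert (r * sg <= r * sin (phi - eta)) by (apply Rmult_le_compat_l; lra).
    assert (0 <= r * k * sin ((1 - b) * eta)) by (apply Rmult_le_pos; [nra | lra]).
    rewrite Hr in *. lra.
  - assert (dl <= sin ((1 - b) * eta)).
    { apply sin_ge_on_arch; [nra|]. unfold phi in *. split; nra. }
    assert (r * (k * dl) <= r * (k * sin ((1 - b) * eta)))
      by (apply Rmult_le_compat_l; [lra|]; apply Rmult_le_compat_l; lra).
    assert (r * 2 <= r * (k * dl)) by (apply Rmult_le_compat_l; lra).
    assert (r * -1 <= r * sin (phi - eta)) by (apply Rmult_le_compat_l; lra).
    assert (r * sg <= r * 1) by (apply Rmult_le_compat_l; lra).
    rewrite Hr in *. lra. }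
assert (k * k * (4 * M / b + 1) <= k * k * (m * sg)) by (apply Rmult_le_compat_l; lra).
unfold Rdiv in *. nra.
Qed.

(** * Points escaping to infinity along the edge *)

Lemma Cmod_le_abs_sum (z : C) : Cmod z <= Rabs (Re z) + Rabs (Im z).
Proof.
pose proof (Rabs_pos (Re z)). pose proof (Rabs_pos (Im z)).
apply Rsqr_incr_0_var; [|lra]. unfold Rsqr. rewrite Cmod2.
pose proof (Rsqr_abs (Re z)) as h1. pose proof (Rsqr_abs (Im z)) as h2.
unfold Rsqr in *. nra.
Qed.

(** On the vertical line [Re s = 1] one has [numer L = i v] with
    [v = exp x * sin t], so the tilted real part of the quotient is its modulus
    times [(cos phi * Im d - sin phi * Re d) / |d|]. Both requirements, that this
    factor be at most [eps] and that the modulus be at least [K], then concern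
    the denominator [d] alone, given [v >= exp x - 1]. They can be met for every
    [t] between [0] and [PI / 2], so [t] is chosen only afterwards. *)
Definition escapes (a phi : R) : Prop := forall eps K : R, 0 < eps -> 0 <= K ->
  exists x : R, 0 < x /\ forall t, 0 <= t <= PI / 2 ->
    cos phi * Im (denom a (x, t)) - sin phi * Re (denom a (x, t))
      <= eps * Cmod (denom a (x, t)) /\
    K * Cmod (denom a (x, t)) <= exp x - 1.

Lemma Re_le_Cmod (z : C) : Re z <= Cmod z.
Proof. eapply Rle_trans; [apply Rle_abs | apply re_le_Cmod]. Qed.

(** The denominator tends to the positive real number [1 / a]. *)
Lemma escapes_pos (a : R) : 0 < a < 1 -> escapes a 0.
Proof.
intros Ha eps K Heps HK. pose proof PI_4 as HPI.
exists (/ (a * eps) + 3 * K / a).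
set (x := / (a * eps) + 3 * K / a).
assert (Hi : 0 < / (a * eps)) by (apply Rinv_0_lt_compat; nra).
assert (Hi2 : 0 <= 3 * K / a) by (apply Rdiv_le_0_compat; lra).
assert (Hx : 0 < x) by (unfold x; lra). split; [exact Hx|].
intros t Ht. rewrite cos_0, sin_0.
set (E := denom a (x, t)).
assert (HRe : Re E = (1 - exp (- (a * x)) * cos (a * t)) / a)
  by (unfold E; rewrite denom_parts by lra; reflexivity).
assert (HIm : Im E = exp (- (a * x)) * sin (a * t) / a)
  by (unfold E; rewrite denom_parts by lra; reflexivity).
assert (Hax : 1 <= a * x * eps).
{ unfold x. replace (a * (/ (a * eps) + 3 * K / a) * eps) with (1 + 3 * K * eps) by (field; lra).
  nra. }
pose proof (exp_pos (- (a * x))) as He0. pose proof (exp_ineq1_le (a * x)) as He1.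
assert (He2 : exp (- (a * x)) * exp (a * x) = 1) by (rewrite <- exp_plus, Rplus_opp_l; apply exp_0).
set (e := exp (- (a * x))) in *.
assert (He3 : e * (1 + a * x) <= 1) by (rewrite <- He2; apply Rmult_le_compat_l; lra).
pose proof (COS_bound (a * t)). pose proof (SIN_bound (a * t)).
assert (Hia : 0 < / a) by (apply Rinv_0_lt_compat; lra).
assert (0 < a * x) by nra.
split.
- assert (B : e <= eps * (1 - e)).
  { assert (e * 1 <= e * (a * x * eps)) by (apply Rmult_le_compat_l; lra). nra. }
  apply Rle_trans with (eps * Re E).
  + assert (h1 : e * sin (a * t) <= e * 1) by (apply Rmult_le_compat_l; lra).
    assert (h2 : e * cos (a * t) <= e * 1) by (apply Rmult_le_compat_l; lra).
    assert (h3 : eps * (1 - e) <= eps * (1 - e * cos (a * t)))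
      by (apply Rmult_le_compat_l; lra).
    rewrite HRe, HIm.
    replace (1 * (e * sin (a * t) / a) - 0 * ((1 - e * cos (a * t)) / a))
      with (e * sin (a * t) * / a) by (unfold Rdiv; ring).
    unfold Rdiv. rewrite <- Rmult_assoc. apply Rmult_le_compat_r; lra.
  + apply Rmult_le_compat_l; [lra | apply Re_le_Cmod].
- assert (B : Cmod E <= 3 / a).
  { eapply Rle_trans; [apply Cmod_le_abs_sum|].
    rewrite HRe, HIm. unfold Rdiv. rewrite !Rabs_mult, (Rabs_pos_eq (/ a)), <- Rmult_plus_distr_r by lra.
    apply Rmult_le_compat_r; [lra|].
    rewrite (Rabs_pos_eq e) by lra.
    assert (Rabs (sin (a * t)) <= 1) by (apply Rabs_le; lra).
    assert (Rabs (1 - e * cos (a * t)) <= 2) by (apply Rabs_le; nra).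
    nra. }
  pose proof (exp_ineq1_le x).
  assert (K * Cmod E <= K * (3 / a)) by (apply Rmult_le_compat_l; lra).
  assert (3 * K / a <= x) by (unfold x; lra). unfold Rdiv in *; nra.
Qed.

(** The denominator [x + i t] has bounded imaginary part, and grows only like [x]. *)
Lemma escapes_zero : escapes 0 0.
Proof.
intros eps K Heps HK. pose proof PI_4 as HPI.
set (x := 2 / eps + 4 * K + 1). exists x.
assert (Hi : 0 < 2 / eps) by (apply Rdiv_lt_0_compat; lra).
assert (Hx : 0 < x) by (unfold x; lra). split; [exact Hx|].
intros t Ht. rewrite denom_0, cos_0, sin_0. unfold Re, Im; simpl.
pose proof (Re_le_Cmod (x, t)) as H1. unfold Re in H1; simpl in H1.
pose proof (Cmod_le_abs_sum (x, t)) as H2. unfold Re, Im in H2; simpl in H2.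
rewrite !Rabs_pos_eq in H2 by lra.
split.
- assert (2 <= eps * x).
  { unfold x. replace (eps * (2 / eps + 4 * K + 1)) with (2 + eps * (4 * K + 1)) by (field; lra). nra. }
  nra.
- pose proof (exp_sub1_ge_quadratic x ltac:(lra)).
  assert (K * Cmod (x, t) <= K * (x + 2)) by (apply Rmult_le_compat_l; lra).
  assert (4 * K <= x) by (unfold x; lra). nra.
Qed.

(** The denominator is [(s ^ b - 1) / b], and [s ^ b] has argument
    [b t <= phi]; hence only the constant [- 1] can contribute positively to
    [cos phi * Im d - sin phi * Re d], which stays bounded while [|d|] grows. *)
Lemma escapes_neg (b : R) : 0 < b < 1 / 2 -> escapes (- b) (b * PI / 2).
Proof.
intros Hb eps K Heps HK. pose proof PI_RGT_0 as HPI.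
set (phi := b * PI / 2).
set (x := (2 / eps + 2 + 6 * (K / b)) / b).
exists x.
assert (Hi : 0 < 2 / eps) by (apply Rdiv_lt_0_compat; lra).
assert (Hbx : b * x = 2 / eps + 2 + 6 * (K / b)) by (unfold x; field; lra).
assert (HKb : 0 <= K / b) by (apply Rdiv_le_0_compat; lra).
assert (Hx : 0 < x) by (apply Rdiv_lt_0_compat; lra). split; [exact Hx|].
intros t Ht.
set (E := denom (- b) (x, t)).
set (k := exp (b * x)).
assert (HRe : b * Re E = k * cos (b * t) - 1).
{ unfold E; rewrite denom_parts by lra. simpl.
  replace (- (- b * x)) with (b * x) by ring.
  replace (- b * t) with (- (b * t)) by ring. rewrite cos_neg. fold k. field. lra. }
assert (HIm : b * Im E = k * sin (b * t)).
{ unfold E; rewrite denom_parts by lra. simpl.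
  replace (- (- b * x)) with (b * x) by ring.
  replace (- b * t) with (- (b * t)) by ring. rewrite sin_neg. fold k. field. lra. }
assert (Hk : 1 + b * x <= k) by apply exp_ineq1_le.
assert (Hu : 1 / 2 <= cos (b * t)).
{ rewrite <- cos_PI3. apply cos_decr_1; nra. }
pose proof (COS_bound (b * t)) as Hu1. pose proof (SIN_bound (b * t)) as Hv.
split; apply Rmult_le_reg_l with b; try lra.
- replace (b * (cos phi * Im E - sin phi * Re E))
    with (sin phi - k * sin (phi - b * t))
    by (rewrite sin_minus;
        replace (b * (cos phi * Im E - sin phi * Re E))
          with (cos phi * (b * Im E) - sin phi * (b * Re E)) by ring;
        rewrite HRe, HIm; ring).
  assert (0 <= sin (phi - b * t)) by (apply sin_ge_0; unfold phi; nra).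
  pose proof (SIN_bound phi).
  assert (0 <= k * sin (phi - b * t)) by (apply Rmult_le_pos; lra).
  assert (H3 : b * Re E <= b * Cmod E) by (apply Rmult_le_compat_l; [lra | apply Re_le_Cmod]).
  assert (H4 : / eps <= b * Re E) by (rewrite HRe; unfold Rdiv in *; nra).
  assert (eps * / eps <= eps * (b * Cmod E)) by (apply Rmult_le_compat_l; lra).
  rewrite Rinv_r in * by lra. lra.
- assert (B : b * Cmod E <= 3 * k).
  { pose proof (Cmod_le_abs_sum E) as H.
    assert (h1 : b * Rabs (Re E) <= 2 * k).
    { rewrite <- (Rabs_pos_eq b) at 1 by lra. rewrite <- Rabs_mult, HRe. apply Rabs_le; nra. }
    assert (h2 : b * Rabs (Im E) <= k).
    { rewrite <- (Rabs_pos_eq b) at 1 by lra. rewrite <- Rabs_mult, HIm. apply Rabs_le; nra. }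
    nra. }
  assert (Hm : exp x = k * exp ((1 - b) * x)) by (unfold k; rewrite <- exp_plus; f_equal; ring).
  pose proof (exp_ineq1_le ((1 - b) * x)) as Hm1.
  assert (H7 : K * (b * Cmod E) <= K * (3 * k)) by (apply Rmult_le_compat_l; lra).
  assert (H8 : k * (1 + (1 - b) * x) <= exp x) by (rewrite Hm; apply Rmult_le_compat_l; lra).
  assert (H9 : k * (1 + b * x) <= k * (1 + (1 - b) * x)) by (apply Rmult_le_compat_l; nra).
  assert (H10 : k * (6 * (K / b)) <= k * (b * x)) by (apply Rmult_le_compat_l; lra).
  assert (H11 : k * (6 * (K / b)) <= exp x - 1) by lra.
  assert (H12 : b * (k * (6 * (K / b))) <= b * (exp x - 1)) by (apply Rmult_le_compat_l; lra).
  replace (b * (k * (6 * (K / b)))) with (6 * (K * k)) in H12 by (field; lra).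
  assert (0 <= K * k) by (apply Rmult_le_pos; lra).
  lra.
Qed.

Lemma tilt_numer_conj (phi x t : R) (E : C) : exp x * cos t = 1 ->
  tilt phi (numer (x, t) * Cconj E) =
  exp x * sin t * (cos phi * Im E - sin phi * Re E).
Proof.
intros H. rewrite numer_parts, H. unfold tilt, Cmult, Cconj, Re, Im; simpl. ring.
Qed.

(** The angle [t] is the one that puts [s = exp (x + i t)] on the line
    [Re s = 1]. *)
Lemma escapes_quotient (a phi eps K : R) :
  -1 < a < 1 -> escapes a phi -> 0 < eps -> 0 <= K ->
  exists x t : R, 0 < x /\ Rabs t < PI / 2 /\ exp x * cos t = 1 /\
    K <= Cmod (numer (x, t) / denom a (x, t)) /\
    tilt phi (numer (x, t) / denom a (x, t))
      <= eps * Cmod (numer (x, t) / denom a (x, t)).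
Proof.
intros Ha Hesc Heps HK. destruct (Hesc eps K Heps HK) as [x [Hx H]].
pose proof PI_RGT_0 as HPI.
assert (He : exp (- x) * exp x = 1) by (rewrite <- exp_plus, Rplus_opp_l; apply exp_0).
pose proof (exp_pos (- x)) as He0.
pose proof (exp_ineq1_le x) as He1.
set (t := acos (exp (- x))).
assert (Hcos : cos t = exp (- x)) by (apply cos_acos; nra).
assert (Ht : 0 <= t < PI / 2).
{ pose proof (acos_bound (exp (- x))) as Hb. fold t in Hb. split; [lra|].
  destruct (Rlt_dec t (PI / 2)) as [h | h]; [exact h|].
  pose proof (cos_decr_1 (PI / 2) t ltac:(lra) ltac:(lra) ltac:(lra) ltac:(lra) ltac:(lra)) as h1.
  rewrite cos_PI2 in h1. lra. }
specialize (H t ltac:(lra)). destruct H as [H1 H2].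
exists x, t.
assert (Hrc : exp x * cos t = 1) by (rewrite Hcos; lra).
assert (Hat : Rabs t < PI / 2) by (rewrite Rabs_pos_eq; lra).
split; [exact Hx|]. split; [exact Hat|]. split; [exact Hrc|].
set (E := denom a (x, t)) in *.
assert (HE : E <> 0%C).
{ apply denom_neq_0; try lra. intros h. unfold RtoC in h. injection h. intros. lra. }
pose proof (proj1 (Cmod_gt_0 _) HE) as HEp.
assert (Hsin : 0 <= sin t <= 1) by (split; [apply sin_ge_0; lra | apply SIN_bound]).
assert (Hv : exp x - 1 <= exp x * sin t).
{ pose proof (sin_sq_cos_sq t) as hs. rewrite Hcos in hs.
  assert (exp (- x) <= 1) by nra. assert (1 - exp (- x) <= sin t) by nra. nra. }
assert (Hn : Cmod (numer (x, t)) = exp x * sin t).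
{ rewrite numer_parts, Hrc. unfold Cmod; simpl.
  replace ((1 - 1) * ((1 - 1) * 1) + exp x * sin t * (exp x * sin t * 1))
    with (Rsqr (exp x * sin t)) by (unfold Rsqr; ring).
  apply sqrt_Rsqr. pose proof (exp_pos x). nra. }
rewrite tilt_div, tilt_numer_conj, Cmod_div, Hn, normsq_Cmod by assumption.
assert (Hq : Cmod E <> 0) by lra.
split.
- apply Rle_div_r; lra.
- apply Rle_div_l; [nra|].
  replace (eps * (exp x * sin t / Cmod E) * (Cmod E * Cmod E))
    with (exp x * sin t * (eps * Cmod E)) by (field; lra).
  apply Rmult_le_compat_l; [pose proof (exp_pos x); nra | exact H1].
Qed.

(** * Parametrization of the punctured disk *)

Lemma Clog_Cexp (L : C) : - PI < Im L <= PI -> Clog (Cexp L) = L.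
Proof.
destruct L as [x y]. unfold Im; simpl. intros Hy.
pose proof (exp_pos x) as Hx.
assert (Hm : Cmod (Cexp (x, y)) = exp x).
{ unfold Cmod, Cexp, Re, Im; simpl.
  replace (exp x * cos y * (exp x * cos y * 1) + exp x * sin y * (exp x * sin y * 1))
    with (exp x * exp x * (sin y * sin y + cos y * cos y)) by ring.
  rewrite sin_sq_cos_sq, Rmult_1_r. apply sqrt_square; lra. }
unfold Clog, Carg. rewrite Hm, ln_exp.
replace (Re (Cexp (x, y)) / exp x) with (cos y) by (unfold Cexp, Re, Im; simpl; field; lra).
unfold Cexp, Re, Im; simpl. f_equal.
destruct (Rle_dec 0 (exp x * sin y)) as [h | h].
- apply acos_cos. split; [|lra]. destruct (Rle_dec 0 y) as [hy | hy]; [exact hy|].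
  pose proof (sin_lt_0_var y ltac:(lra) ltac:(lra)). nra.
- destruct (Rle_dec 0 y) as [hy | hy].
  + pose proof (sin_ge_0 y ltac:(lra) ltac:(lra)). nra.
  + rewrite <- cos_neg, acos_cos; lra.
Qed.

Lemma Cexp_opp (L : C) : (Cexp L * Cexp (- L) = 1)%C.
Proof.
destruct L as [x y]. unfold Cexp, Cmult, Copp, RtoC, Re, Im; simpl. rewrite cos_neg, sin_neg.
assert (He : exp x * exp (- x) = 1) by (rewrite <- exp_plus, Rplus_opp_r; apply exp_0).
pose proof (sin_sq_cos_sq y) as Hs.
f_equal; [|ring].
replace (exp x * cos y * (exp (- x) * cos y) - exp x * sin y * (exp (- x) * - sin y))
  with (exp x * exp (- x) * (sin y * sin y + cos y * cos y)) by ring.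
rewrite He, Hs; ring.
Qed.

Definition disk_point (L : C) : C := (1 - Cexp (- L))%C.

Lemma psi_disk_point (c x t : R) :
  -1 < c - 1 < 1 -> -1 <= x -> Rabs t < PI / 2 -> (x, t) <> RtoC 0 ->
  psi c (disk_point (x, t)) = (numer (x, t) / denom (c - 1) (x, t))%C.
Proof.
intros Hc Hx Ht HL. pose proof PI_RGT_0 as HPI.
pose proof (Rabs_def2 _ _ Ht) as Ht2.
pose proof (denom_neq_0 (c - 1) x t Hc Hx ltac:(lra) HL) as Hd.
set (L := (x, t) : C) in *.
assert (Hlog : Clog (Cexp (- L)) = (- L)%C) by (apply Clog_Cexp; unfold L; simpl; lra).
pose proof (Cexp_opp L) as Hinv.
unfold psi, disk_point.
replace (1 - (1 - Cexp (- L)))%C with (Cexp (- L)) by ring.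
unfold Cpower. rewrite Hlog.
assert (Hw : Cexp (- L) <> 0%C).
{ intros h. rewrite h, Cmult_0_r in Hinv. injection Hinv. lra. }
assert (Hs : Cexp L = (1 / Cexp (- L))%C) by (rewrite <- Hinv; field; exact Hw).
destruct (Ceq_dec (1 - Cexp (- L)) 0) as [h | _].
{ exfalso. apply HL. assert (h1 : Cexp (- L) = Cexp 0).
  { replace (Cexp 0) with (1 : C) by (unfold Cexp; simpl; rewrite exp_0, cos_0, sin_0; unfold RtoC; f_equal; ring).
    replace (Cexp (- L)) with (1 - (1 - Cexp (- L)))%C by ring. rewrite h. ring. }
  apply (f_equal Clog) in h1. rewrite Hlog, Clog_Cexp in h1 by (simpl; lra).
  assert (h2 : @eq C L (- - L)%C) by ring. rewrite h2, h1.
  unfold Copp, RtoC; simpl. f_equal; ring. }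
unfold numer, denom in *. rewrite Hs.
destruct (Req_dec_T c 1) as [-> | Hc1].
- destruct (Req_dec_T (1 - 1) 0) as [_ | n]; [|lra].
  field. auto.
- destruct (Req_dec_T (c - 1) 0) as [n | n]; [lra|].
  replace (RtoC (c - 1) * - L)%C with (RtoC (- (c - 1)) * L)%C by (rewrite RtoC_opp; ring).
  set (p := Cexp (RtoC (- (c - 1)) * L)) in *.
  assert (Ha : RtoC (c - 1) <> 0%C) by (intros h; injection h; lra).
  assert (Hp : (1 - p)%C <> 0%C).
  { intros h. apply Hd. rewrite h. field. exact Ha. }
  field. auto.
Qed.

(** The bound [-1 <= x] comes from [|1 - z| <= 2 < exp 1]. *)
Lemma disk_point_onto (z : C) : unit_disk z -> z <> 0%C ->
  exists x t : R, -1 <= x /\ Rabs t < PI / 2 /\ (x, t) <> RtoC 0 /\ z = disk_point (x, t).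
Proof.
intros Hz Hz0. unfold unit_disk in Hz.
set (w := (1 - z)%C).
assert (Hre : 0 < Re w).
{ pose proof (Re_le_Cmod z). unfold w. destruct z; simpl in *. lra. }
assert (Hw : w <> 0%C) by (intros h; rewrite h in Hre; simpl in Hre; lra).
assert (Hmw : 0 < Cmod w) by (apply Cmod_gt_0; exact Hw).
assert (Hw2 : Cmod w <= 2).
{ unfold w, Cminus. eapply Rle_trans; [apply Cmod_triangle|].
  rewrite Cmod_opp, Cmod_1. lra. }
exists (- ln (Cmod w)), (- Carg w).
assert (HL : ((- ln (Cmod w), - Carg w) : C) = (- Clog w)%C) by reflexivity.
split; [|split; [|split]].
- pose proof (exp_ineq1_le (ln (Cmod w))) as h. rewrite exp_ln in h by exact Hmw. lra.
- rewrite Rabs_Ropp. pose proof (Re_div_Cmod_bound w Hw) as Hb.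
  assert (Hq : 0 < Re w / Cmod w) by (apply Rdiv_lt_0_compat; lra).
  pose proof (acos_bound (Re w / Cmod w)) as Hab.
  assert (Hac : acos (Re w / Cmod w) < PI / 2).
  { destruct (Rlt_dec (acos (Re w / Cmod w)) (PI / 2)) as [h | h]; [exact h|].
    pose proof PI_RGT_0.
    pose proof (cos_decr_1 (PI / 2) (acos (Re w / Cmod w)) ltac:(lra) ltac:(lra) ltac:(lra) ltac:(lra) ltac:(lra)) as h1.
    rewrite cos_PI2, cos_acos in h1 by exact Hb. lra. }
  unfold Carg. destruct (Rle_dec 0 (Im w)); apply Rabs_def1; lra.
- intros h. apply Hz0. rewrite HL in h.
  assert (h1 : Clog w = 0%C) by (replace (Clog w) with (- - Clog w)%C by ring; rewrite h; ring).
  pose proof (Cexp_Clog w Hw) as h2. rewrite h1 in h2.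
  replace z with (1 - w)%C by (unfold w; ring). rewrite <- h2.
  unfold Cexp, Cminus, Cplus, Copp, RtoC, Re, Im; simpl. rewrite exp_0, cos_0, sin_0. f_equal; ring.
- unfold disk_point. rewrite HL. replace (- - Clog w)%C with (Clog w) by ring.
  rewrite Cexp_Clog by exact Hw. unfold w; ring.
Qed.

Lemma disk_point_in_disk (x t : R) : exp x * cos t = 1 -> unit_disk (disk_point (x, t)).
Proof.
intros H. unfold unit_disk.
assert (He : exp x * exp (- x) = 1) by (rewrite <- exp_plus, Rplus_opp_r; apply exp_0).
pose proof (exp_pos (- x)) as H0.
assert (Hc : cos t = exp (- x)).
{ replace (cos t) with (exp (- x) * (exp x * cos t)) by (rewrite <- Rmult_assoc, (Rmult_comm (exp (- x))), He; ring).
  rewrite H; ring. }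
pose proof (Cmod2 (disk_point (x, t))) as Hm. pose proof (Cmod_ge_0 (disk_point (x, t))).
assert (Hv : Re (disk_point (x, t)) * Re (disk_point (x, t)) + Im (disk_point (x, t)) * Im (disk_point (x, t)) = 1 - exp (- x) * exp (- x)).
{ unfold disk_point, Cexp, Re, Im; simpl. rewrite cos_neg, sin_neg.
  pose proof (sin_sq_cos_sq t) as hs. rewrite Hc in hs |- *. nra. }
nra.
Qed.

(** * Nonconvexity *)

(** If the points of [S] in each half-plane [tilt <= M] form a bounded set, and
    [S] has points tending to infinity along which [tilt] is negligible compared
    with the modulus, then [S] is not convex. For on the segment from [p0] to such a
    far point [p], the point at distance about [H] from [p0] has [tilt] at most
    [|tilt p0| + 1] once [eps <= 1 / H], while [H] is larger than the bound for
    that half-plane. *)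
Lemma not_convex_of_flat_escape (S : C -> Prop) (phi : R) (p0 : C) :
  S p0 ->
  (forall M, exists K, forall p, S p -> tilt phi p <= M -> Cmod p <= K) ->
  (forall eps K, 0 < eps -> 0 <= K ->
     exists p, S p /\ K <= Cmod p /\ tilt phi p <= eps * Cmod p) ->
  ~ convex_subset S.
Proof.
intros Hp0 Hbounded Hesc Hconv.
destruct (Hbounded (Rabs (tilt phi p0) + 1)) as [K HK].
pose proof (Cmod_ge_0 p0) as H0.
set (H := Rabs K + Cmod p0 + 1).
pose proof (Rabs_pos K) as HaK. pose proof (Rle_abs K) as HaK'.
assert (HH : 0 < H) by (unfold H; lra).
destruct (Hesc (/ H) H (Rinv_0_lt_compat _ HH) ltac:(lra)) as [p [Hp [Hlarge Hflat]]].
set (tau := H / Cmod p).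
assert (Htau : 0 <= tau <= 1).
{ unfold tau. split; [apply Rdiv_le_0_compat; lra | apply Rle_div_l; lra]. }
pose proof (Hconv p0 p tau Hp0 Hp Htau) as Hq.
set (q := (RtoC (1 - tau) * p0 + RtoC tau * p)%C) in *.
assert (Htp : tau * Cmod p = H) by (unfold tau; field; lra).
assert (Htilt : tilt phi q = (1 - tau) * tilt phi p0 + tau * tilt phi p).
{ unfold q, tilt. destruct p0, p; simpl. ring. }
assert (B1 : tilt phi q <= Rabs (tilt phi p0) + 1).
{ rewrite Htilt. pose proof (Rle_abs (tilt phi p0)). pose proof (Rabs_pos (tilt phi p0)).
  assert ((1 - tau) * tilt phi p0 <= Rabs (tilt phi p0)) by nra.
  assert (tau * tilt phi p <= tau * (/ H * Cmod p)) by (apply Rmult_le_compat_l; lra).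
  replace (tau * (/ H * Cmod p)) with (/ H * (tau * Cmod p)) in * by ring.
  rewrite Htp, Rinv_l in * by lra. lra. }
pose proof (HK q Hq B1) as B2.
assert (B3 : Cmod (RtoC tau * p) <= Cmod q + Cmod p0).
{ replace (RtoC tau * p)%C with (q + - (RtoC (1 - tau) * p0))%C by (unfold q; ring).
  eapply Rle_trans; [apply Cmod_triangle|]. rewrite Cmod_opp, Cmod_mult, Cmod_R.
  rewrite Rabs_pos_eq by lra. nra. }
rewrite Cmod_mult, Cmod_R, Rabs_pos_eq, Htp in B3 by lra.
unfold H in B3. lra.
Qed.

(** The two hypotheses on the exponent enter here: [a < 1] for [a > 0] and
    [a > - 1 / 2] for [a < 0] make the second-order term of the quotient
    unbounded. *)
Lemma exists_direction (a : R) : - (1 / 2) < a < 1 ->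
  exists phi, tilt_grows a phi /\ escapes a phi.
Proof.
intros Ha. destruct (Rtotal_order a 0) as [H | [-> | H]].
- exists (- a * PI / 2). split.
  + pose proof (tilt_grows_neg (- a) ltac:(lra)) as h. rewrite Ropp_involutive in h. exact h.
  + pose proof (escapes_neg (- a) ltac:(lra)) as h. rewrite Ropp_involutive in h. exact h.
- exists 0. split; [exact tilt_grows_zero | exact escapes_zero].
- exists 0. split; [apply tilt_grows_pos; lra | apply escapes_pos; lra].
Qed.

Lemma psi_half_plane_bounded (c phi M : R) : 1 / 2 < c < 2 -> tilt_grows (c - 1) phi ->
  exists K, forall p, image_of unit_disk (psi c) p -> tilt phi p <= M -> Cmod p <= K.
Proof.
intros Hc Hgrow.
destruct (Hgrow (Rabs M + 1) ltac:(pose proof (Rabs_pos M); lra)) as [X HX].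
destruct (quotient_bounded (c - 1) (Rmax 1 X) ltac:(lra) (Rmax_l _ _)) as [K HK].
exists (Rmax 1 K). intros p [z [Hz <-]] Hp.
destruct (Ceq_dec z 0) as [-> | Hz0].
{ unfold psi. destruct (Ceq_dec 0 0) as [_ | n]; [|contradiction n; reflexivity].
  rewrite Cmod_1. apply Rmax_l. }
destruct (disk_point_onto z Hz Hz0) as [x [t [Hx [Ht [HL ->]]]]].
rewrite psi_disk_point in * by (auto; lra).
destruct (Rle_dec x (Rmax 1 X)) as [h | h].
- eapply Rle_trans; [apply HK; auto; lra | apply Rmax_r].
- exfalso. pose proof (Rmax_r 1 X).
  pose proof (denom_neq_0 (c - 1) x t ltac:(lra) Hx ltac:(lra) HL) as Hd.
  pose proof (normsq_pos _ Hd) as Hs.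
  specialize (HX x t ltac:(lra) ltac:(lra)).
  rewrite tilt_div in Hp by exact Hd.
  apply Rle_div_l in Hp; [|exact Hs].
  pose proof (Rle_abs M). nra.
Qed.

Theorem proposition1 (c : R) (hc : 1 / 2 < c < 2) :
  ~ convex_in_unit_disk (psi c).
Proof.
intros [_ Hconv].
destruct (exists_direction (c - 1) ltac:(lra)) as [phi [Hgrow Hesc]].
revert Hconv. apply (not_convex_of_flat_escape _ phi (psi c 0)).
- exists 0%C. split; [unfold unit_disk; rewrite Cmod_0; lra | reflexivity].
- intros M. apply psi_half_plane_bounded; assumption.
- intros eps K Heps HK.
  destruct (escapes_quotient (c - 1) phi eps K ltac:(lra) Hesc Heps HK)
    as [x [t [Hx [Ht [Hrc [H1 H2]]]]]].
  assert (HL : (x, t) <> RtoC 0) by (intros h; injection h; intros; lra).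
  exists (numer (x, t) / denom (c - 1) (x, t))%C. repeat split; try assumption.
  exists (disk_point (x, t)). split; [apply disk_point_in_disk; exact Hrc|].
  apply psi_disk_point; auto; lra.
Qed.
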